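(* Let $\gamma\subset\mathbb{RP}^2$ be a locally convex curve with a parametrization $[A(t)]$ whose tautological ODE is in the Laguerre–Forsyth form $A'''+rA=0$. Let $i:\gamma\to\mathbb{RP}^2$ be a projective involute with locally convex image and $i(q)\ne q$ for all $q\in\gamma$, given in homogeneous coordinates by $[A(t)]\mapsto[B(t)]$, $B=xA+yA'$, where the lift $B$ is normalized so that $B'''$ is proportional to $B$; in this case $x=C-y'$ for some constant $C$, and $y$ satisfies $$y^{(4)}+2\frac{y'''(y'-C)}{y}+3ry'+r'y=0.$$ Then $b=B\times B'$ (i.e. the curve $[b(t)]$ in $\mathbb{RP}^{2*}$) is a dancing mate of $[A(t)]$ if and only if $x+y'=0$, that is, $C=0$, so that $y$ satisfies the ODE $$y^{(4)}+2\frac{y'''y'}{y}+3ry'+r'y=0.$$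
   Context: Columns $\mathbf q\in\mathbb R^3$, rows $\mathbf p\in(\mathbb R^3)^*$, $\mathbf p\mathbf q=p_iq^i$, $(\mathbf v\times\mathbf w)_i=\epsilon_{ijk}v^jw^k$ on $\mathbb R^3$. $\mathbb{RP}^2=\mathbb P(\mathbb R^3)$, $\mathbb{RP}^{2*}=\mathbb P((\mathbb R^3)^* )$. A regular curve in $\mathbb{RP}^2$ is locally convex if it has no inflection points, i.e. $\det(\mathbf q,\mathbf q',\mathbf q'')\ne0$ for a parametrized lift $\mathbf q(t)$. A lift $\mathbf q(t)\in\mathbb R^3\setminus0$ then satisfies a unique tautological ODE $\mathbf q'''+a_2\mathbf q''+a_1\mathbf q'+a_0\mathbf q=0$. By reparametrizing and rescaling one can locally achieve the Laguerre–Forsyth (LF) form $a_1=a_2=0$; the LF parameter $t$ is unique up to Möbius transformations, so LF parameters define a projective structure (an atlas of $\mathbb{RP}^1$-valued charts with Möbius transition maps) on every locally convex curve, and likewise for curves in $\mathbb{RP}^{2*}$. A projective involute of a locally convex curve $\gamma$ is a smooth immersion $i:\gamma\to\mathbb{RP}^2$ such that $i(q)$ lies on the tangent line to $\gamma$ at $q$ for all $q\in\gamma$, and such that the local diffeomorphism $\gamma\to i(\gamma)$ is projective for the natural projective structures. A dancing pair is a pair of curves $q(t)=[\mathbf q(t)]$, $p(t)=[\mathbf p(t)]$ obtained from an integral curve $(\mathbf q(t),\mathbf p(t))$ of $(Q^5,\mathcal D)$, i.e. satisfying $\mathbf p\mathbf q=1$, $\mathbf p'=\mathbf q\times\mathbf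 q'$; then $p(t)$ is called a dancing mate of $q(t)$. *)

(* Defs.v *)
From HB Require Import structures.
From mathcomp Require Import all_boot all_order all_algebra.
From mathcomp Require Import all_classical all_reals all_analysis.
Set Implicit Arguments.
Unset Strict Implicit.
Unset Printing Implicit Defensive.
Import Order.TTheory GRing.Theory Num.Theory.
Import numFieldNormedType.Exports.
Local Open Scope ring_scope.
Local Open Scope classical_set_scope.

(* Conventions.  A point of P(V) is a one-dimensional subspace L : {vspace V},
   and [v] is <[v]>%VS (the zero subspace is not a point, and never satisfies
   [curve_lift] or [dancing_mate] below).  A curve in P(V) is a function
   R -> {vspace V}, looked at only on a given open set of parameters.  A map
   from a parametrized curve gamma to P(V) is given as a function of the
   parameter.  Derivatives at points of an open set only depend on the values
   on that set. *)

Definition smooth_on (R : realType) (V : normedModType R) (J : set R)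
    (f : R -> V) : Prop :=
  forall (n : nat) (t : R), J t -> derivable (derive1n n f) t 1.

(* Indices are taken mod 3: (v x w)_i = v_(i+1) w_(i+2) - v_(i+2) w_(i+1),
   which is epsilon_ijk v^j w^k. *)
Definition cross (R : realType) (v w : 'cV[R]_3) : 'rV[R]_3 :=
  \row_(i < 3) (v (i + 1) 0 * w (i + 2%:R) 0 - v (i + 2%:R) 0 * w (i + 1) 0).

Definition det3 (R : realType) (u v w : 'cV[R]_3) : R :=
  \det (\matrix_(i < 3, j < 3) ([:: u; v; w]`_j) i 0).

Definition curve_lift (R : realType) (J : set R) (c : R -> {vspace 'cV[R]_3})
    (V : R -> 'cV[R]_3) : Prop :=
  smooth_on J V /\ forall t, J t -> V t != 0 /\ c t = <[V t]>%VS.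

Definition local_lift (R : realType) (c : R -> {vspace 'cV[R]_3}) (t : R)
    (V : R -> 'cV[R]_3) : Prop :=
  exists J : set R, [/\ open J, J t & curve_lift J c V].

(* The three notions below do not depend on the choice of the local lift. *)
Definition immersion (R : realType) (I : set R)
    (c : R -> {vspace 'cV[R]_3}) : Prop :=
  forall t, I t -> exists V, local_lift c t V /\ free [:: V t; derive1 V t].

Definition locally_convex_curve (R : realType) (I : set R)
    (c : R -> {vspace 'cV[R]_3}) : Prop :=
  forall t, I t ->
    exists V, local_lift c t V /\ det3 (V t) (derive1 V t) (derive1n 2 V t) != 0.

Definition on_tangent_line (R : realType) (c : R -> {vspace 'cV[R]_3}) (t : R)
    (P : {vspace 'cV[R]_3}) : Prop :=
  exists V, local_lift c t V /\ (P <= <<[:: V t; derive1 V t]>>)%VS.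

(* The tautological ODE of A is in Laguerre-Forsyth form, a_2 = a_1 = 0 and
   a_0 = r. *)
Definition LF_ode (R : realType) (J : set R) (A : R -> 'cV[R]_3)
    (r : R -> R) : Prop :=
  forall t, J t -> derive1n 3 A t + r t *: A t = 0.

(* u is a new parameter s = u(t) on the piece t \in J of the locally convex
   curve c, such that, as a function of s, the curve has a lift V whose
   tautological ODE is in Laguerre-Forsyth form.  These u are the charts of the
   projective structure of c.  For J open, u @` J is open since u' != 0. *)
Definition LF_parameter (R : realType) (J : set R)
    (c : R -> {vspace 'cV[R]_3}) (u : R -> R) : Prop :=
  [/\ smooth_on J u, forall t, J t -> derive1 u t != 0 &
    exists (V : R -> 'cV[R]_3) (r : R -> R),
      [/\ smooth_on (u @` J) V,
          forall t, J t -> V (u t) != 0 /\ c t = <[V (u t)]>%VS &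
          LF_ode (u @` J) V r]].

(* The local diffeomorphism c1(t) |-> c2(t) between locally convex curves is
   projective: near every point it is a Moebius transformation in terms of
   Laguerre-Forsyth parameters of c1 and c2. *)
Definition projective_map (R : realType) (I : set R)
    (c1 c2 : R -> {vspace 'cV[R]_3}) : Prop :=
  forall t, I t -> exists (J : set R) (u v : R -> R),
    [/\ open J, is_interval J, J t & J `<=` I] /\
    [/\ LF_parameter J c1 u, LF_parameter J c2 v &
      exists a b c d : R, a * d - b * c != 0 /\
        forall s, J s ->
          c * u s + d != 0 /\ v s = (a * u s + b) / (c * u s + d)].

Definition projective_involute (R : realType) (I : set R)
    (gamma invol : R -> {vspace 'cV[R]_3}) : Prop :=
  [/\ immersion I invol,
      forall t, I t -> on_tangent_line gamma t (invol t) &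
      projective_map I gamma invol].

(* The curve p in P((R^3)^* ) is a dancing mate of q: they are the projections
   of an integral curve of (Q^5, D), where Q^5 is given by p q = 1 and D by
   dp = q x dq. *)
Definition dancing_mate (R : realType) (I : set R)
    (q : R -> {vspace 'cV[R]_3}) (p : R -> {vspace 'rV[R]_3}) : Prop :=
  exists (qq : R -> 'cV[R]_3) (pp : R -> 'rV[R]_3),
    [/\ smooth_on I qq, smooth_on I pp &
      forall t, I t ->
        [/\ q t = <[qq t]>%VS, p t = <[pp t]>%VS,
            pp t *m qq t = 1%:M & derive1 pp t = cross (qq t) (derive1 qq t)]].

(* Main.v *)
Require Import Defs.
From HB Require Import structures.
From mathcomp Require Import all_boot all_order all_algebra.
From mathcomp Require Import all_classical all_reals all_analysis.
From mathcomp Require Import ring.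
Set Implicit Arguments.
Unset Strict Implicit.
Unset Printing Implicit Defensive.
Import Order.TTheory GRing.Theory Num.Theory.
Import numFieldNormedType.Exports.
Local Open Scope ring_scope.
Local Open Scope classical_set_scope.

(* Let D = det(A, A', A'') and W = det(B, B', B''): both are constant on I, and
   nonzero by local convexity.  Differentiating B = x A + y A' three times in
   the frame (A, A', A'') and comparing with B''' = l B yields x' + y'' = 0 and
   the fourth order equation for y.
   A dancing pair is (f A, g b) with b = B x B' and f g y^2 D = 1.  Testing
   (g b)' = (f A) x (f A)' on the basis (A, B, B') gives the two equations
   g' y + g (x + 2 y') = 0 and - g W = f^2 y D.  The second one says
   - (g y)^3 W D = 1, so g y is constant, and then the first one reads
   g (x + y') = 0.  Conversely, if x + y' = 0, then g = k / y is a solution for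
   the cube root k of - 1 / (W D). *)

(** * Locality of derivatives and closure properties of smoothness on an open set *)

Lemma eq_on_near (R : realType) (V : normedModType R) (J : set R)
    (f g : R -> V) :
  open J -> (forall t, J t -> f t = g t) ->
  forall t, J t -> \near t, f t = g t.
Proof.
move=> oJ fg t Jt; have : nbhs t J by exact: open_nbhs_nbhs.
by apply: filterS.
Qed.

Lemma eq_derive1n (R : realType) (V : normedModType R) (J : set R)
    (f g : R -> V) :
  open J -> (forall t, J t -> f t = g t) ->
  forall n t, J t -> derive1n n f t = derive1n n g t.
Proof.
move=> oJ fg; elim=> [//|n IH] t Jt.
by rewrite !derive1nS !derive1E; apply: near_eq_derive; exact: eq_on_near IH _ Jt.
Qed.

Lemma eq_derive1 (R : realType) (V : normedModType R) (J : set R)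
    (f g : R -> V) :
  open J -> (forall t, J t -> f t = g t) ->
  forall t, J t -> derive1 f t = derive1 g t.
Proof. move=> oJ fg; exact: (eq_derive1n oJ fg 1). Qed.

Lemma eq_smooth_on (R : realType) (V : normedModType R) (J : set R)
    (f g : R -> V) :
  open J -> (forall t, J t -> f t = g t) -> smooth_on J f -> smooth_on J g.
Proof.
move=> oJ fg sf n t Jt.
apply: near_eq_derivable (sf n t Jt).
exact: (eq_on_near oJ (eq_derive1n oJ fg n)).
Qed.

Lemma smooth_on_subset (R : realType) (V : normedModType R) (J K : set R)
    (f : R -> V) : J `<=` K -> smooth_on K f -> smooth_on J f.
Proof. by move=> JK sf n t /JK; exact: sf. Qed.

Lemma smooth_on_derive1n (R : realType) (V : normedModType R) (J : set R)
    (f : R -> V) (n : nat) : smooth_on J f -> smooth_on J (derive1n n f).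
Proof.
by move=> sf m t Jt; rewrite /derive1n -iterD; exact: (sf (m + n)%N t Jt).
Qed.

Lemma smooth_on_derive1 (R : realType) (V : normedModType R) (J : set R)
    (f : R -> V) : smooth_on J f -> smooth_on J (derive1 f).
Proof. exact: (@smooth_on_derive1n _ _ _ _ 1). Qed.

Lemma smooth_on_is_derive (R : realType) (V : normedModType R) (J : set R)
    (f : R -> V) (n : nat) (t : R) :
  smooth_on J f -> J t -> is_derive t 1 (derive1n n f) (derive1n n.+1 f t).
Proof.
by move=> sf Jt; rewrite derive1nS derive1E; apply: DeriveDef => //; exact: sf.
Qed.

Lemma is_derive1_derive1 (R : realType) (V : normedModType R)
    (f : R -> V) (t : R) (df : V) : is_derive t 1 f df -> derive1 f t = df.
Proof. by move=> fd; rewrite derive1E; exact: derive_val. Qed.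

(** The recursion passes to the first derivative, so that closure under products and inverses
    follows by induction from the first-order rules alone, without a Leibniz formula for the n-th
    derivative. *)
Fixpoint Cn_on (R : realType) (V : normedModType R) (n : nat) (J : set R)
    (f : R -> V) : Prop :=
  if n is m.+1 then
    (forall t, J t -> derivable f t 1) /\ Cn_on m J (derive1 f)
  else True.

Lemma smooth_onP (R : realType) (V : normedModType R) (J : set R)
    (f : R -> V) : smooth_on J f <-> forall n, Cn_on n J f.
Proof.
split=> [+ n|].
  elim: n f => [//|n IH] f sf /=; split; first exact: (sf 0%N).
  exact/IH/smooth_on_derive1.
move=> Cf n; elim: n f Cf => [|n IH] f Cf t Jt; first exact: (Cf 1%N).1.
by rewrite derive1Sn; apply: IH => // m; exact: (Cf m.+1).2.
Qed.

(** The derivative of a product or an inverse involves the undifferentiated factors, which the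
    induction needs at the lower order. *)
Lemma Cn_onS (R : realType) (V : normedModType R) (n : nat) (J : set R)
    (f : R -> V) : Cn_on n.+1 J f -> Cn_on n J f.
Proof.
elim: n f => [//|n IH] f [df Cf]; split=> //; exact: IH.
Qed.

Lemma eq_Cn_on (R : realType) (V : normedModType R) (n : nat) (J : set R)
    (f g : R -> V) :
  open J -> (forall t, J t -> f t = g t) -> Cn_on n J f -> Cn_on n J g.
Proof.
move=> oJ; elim: n f g => [//|n IH] f g fg [df Cf]; split.
  move=> t Jt; apply: near_eq_derivable (df t Jt); exact: (eq_on_near oJ fg).
exact: IH (eq_derive1 oJ fg) Cf.
Qed.

Lemma Cn_onD (R : realType) (V : normedModType R) (n : nat) (J : set R)
    (f g : R -> V) :
  open J -> Cn_on n J f -> Cn_on n J g -> Cn_on n J (fun t => f t + g t).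
Proof.
move=> oJ; elim: n f g => [//|n IH] f g [df Cf] [dg Cg]; split.
  move=> t Jt; exact: derivableD (df t Jt) (dg t Jt).
apply: eq_Cn_on (IH _ _ Cf Cg) => // t Jt; rewrite !derive1E.
by rewrite (deriveD (df t Jt) (dg t Jt)).
Qed.

Lemma Cn_onM (R : realType) (n : nat) (J : set R) (f g : R -> R) :
  open J -> Cn_on n J f -> Cn_on n J g -> Cn_on n J (fun t => f t * g t).
Proof.
move=> oJ; elim: n f g => [//|n IH] f g Cf Cg.
have [df Cf'] := Cf; have [dg Cg'] := Cg; split.
  move=> t Jt; exact: derivableM (df t Jt) (dg t Jt).
apply: eq_Cn_on (Cn_onD oJ (IH _ _ (Cn_onS Cf) Cg')
  (IH _ _ (Cn_onS Cg) Cf')) => // t Jt; rewrite !derive1E.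
by rewrite (deriveM (df t Jt) (dg t Jt)).
Qed.

(** The derivative of 1/f is -1 times (1/f)(1/f) times f', where 1/f is covered by the induction
    hypothesis at the lower order. *)
Lemma Cn_onV (R : realType) (n : nat) (J : set R) (f : R -> R) :
  open J -> (forall t, J t -> f t != 0) -> Cn_on n J f ->
  Cn_on n J (fun t => (f t)^-1).
Proof.
move=> oJ f0; elim: n => [//|n IH] Cf.
have [df Cf'] := Cf; split.
  move=> t Jt; exact: derivableV (f0 t Jt) (df t Jt).
(* The induction runs over all constants, since the derivative of the constant -1 is the constant
   0. *)
have Cn1 : Cn_on n J (cst (- 1 : R)).
  elim: n {IH Cf Cf'} (-1 : R) => [//|n IH] c; split.
    by move=> t _; exact: derivable_cst.
  by apply: eq_Cn_on (IH 0) => // t _; rewrite derive1_cst.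
have Cfi := IH (Cn_onS Cf).
apply: eq_Cn_on (Cn_onM oJ (Cn_onM oJ Cn1 (Cn_onM oJ Cfi Cfi)) Cf') => // t Jt.
rewrite !derive1E (deriveV (f0 t Jt) (df t Jt)) /cst -exprVn expr2 mulN1r.
by [].
Qed.

Lemma smooth_onD (R : realType) (V : normedModType R) (J : set R)
    (f g : R -> V) : open J ->
  smooth_on J f -> smooth_on J g -> smooth_on J (fun t => f t + g t).
Proof.
by move=> oJ /smooth_onP Cf /smooth_onP Cg; apply/smooth_onP => n; exact: Cn_onD.
Qed.

Lemma smooth_onM (R : realType) (J : set R) (f g : R -> R) : open J ->
  smooth_on J f -> smooth_on J g -> smooth_on J (fun t => f t * g t).
Proof.
by move=> oJ /smooth_onP Cf /smooth_onP Cg; apply/smooth_onP => n; exact: Cn_onM.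
Qed.

Lemma smooth_onV (R : realType) (J : set R) (f : R -> R) : open J ->
  (forall t, J t -> f t != 0) -> smooth_on J f ->
  smooth_on J (fun t => (f t)^-1).
Proof.
by move=> oJ f0 /smooth_onP Cf; apply/smooth_onP => n; exact: Cn_onV.
Qed.

Lemma smooth_on_cst (R : realType) (V : normedModType R) (J : set R) (c : V) :
  smooth_on J (cst c).
Proof.
move=> n; elim: n c => [|n IH] c t Jt; first exact: derivable_cst.
rewrite derive1Sn.
have -> : derive1 (cst c) = cst (0 : V) by apply/funext => s; rewrite derive1_cst.
exact: IH.
Qed.

Lemma smooth_onN (R : realType) (J : set R) (f : R -> R) : open J ->
  smooth_on J f -> smooth_on J (fun t => - f t).
Proof.
move=> oJ sf; have := smooth_onM oJ (@smooth_on_cst _ _ J (-1 : R)) sf.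
apply: eq_smooth_on => //.
by move=> t _; rewrite mulN1r.
Qed.

Lemma smooth_onB (R : realType) (J : set R) (f g : R -> R) : open J ->
  smooth_on J f -> smooth_on J g -> smooth_on J (fun t => f t - g t).
Proof. move=> oJ sf sg; have := smooth_onD oJ sf (smooth_onN oJ sg); exact. Qed.

(** * Matrix-valued functions, entry by entry *)

Lemma derive1n_mxE (R : realType) (m n : nat) (J : set R)
    (M : R -> 'M[R]_(m, n)) (k : nat) (t : R) (i : 'I_m) (j : 'I_n) :
  open J -> smooth_on J M -> J t ->
  derive1n k M t i j = derive1n k (fun s => M s i j) t.
Proof.
move=> oJ sM; elim: k t => [//|k IH] t Jt.
rewrite !derive1nS !derive1E (derive_mx (sM k t Jt)) mxE.
by apply: near_eq_derive; exact: eq_on_near IH _ Jt.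
Qed.

Lemma smooth_on_mxP (R : realType) (m n : nat) (J : set R)
    (M : R -> 'M[R]_(m, n)) : open J ->
  smooth_on J M <-> forall i j, smooth_on J (fun t => M t i j).
Proof.
move=> oJ; split=> [sM i j k t Jt|sM k].
  have /derivable_mxP/(_ i j) := sM k t Jt.
  apply: near_eq_derivable.
  exact: (eq_on_near oJ (fun s => @derive1n_mxE _ _ _ _ _ k s i j oJ sM) Jt).
(* Derivability and the entry formula go through one induction: the formula at order k+1 needs
   derivability at order k, and derivability at order k+1 needs the formula at all nearby points. *)
suff H t : J t -> derivable (derive1n k M) t 1 /\
    forall i j, derive1n k M t i j = derive1n k (fun s => M s i j) t.
  by move=> t /H[].
elim: k t => [|k IH] t Jt.
  by split=> //; apply/derivable_mxP => i j; exact: (sM i j 0%N).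
have E s i j : J s -> derive1n k.+1 M s i j = derive1n k.+1 (fun s => M s i j) s.
  move=> Js; rewrite !derive1nS !derive1E (derive_mx (IH s Js).1) mxE.
  apply: near_eq_derive; exact: (eq_on_near oJ (fun u Ju => (IH u Ju).2 i j) Js).
split=> [|i j]; last exact: E.
apply/derivable_mxP => i j.
apply: near_eq_derivable (sM i j k.+1 t Jt).
exact: (eq_on_near oJ (fun s Js => esym (E s i j Js)) Jt).
Qed.

Lemma smooth_onZ (R : realType) (m n : nat) (J : set R) (f : R -> R)
    (M : R -> 'M[R]_(m, n)) : open J ->
  smooth_on J f -> smooth_on J M -> smooth_on J (fun t => f t *: M t).
Proof.
move=> oJ sf sM; apply/(smooth_on_mxP _ oJ) => i j.
have sMij := (smooth_on_mxP M oJ).1 sM i j.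
have := smooth_onM oJ sf sMij; apply: eq_smooth_on => // t _.
by rewrite mxE.
Qed.

Lemma is_derive_mxP (R : realType) (m n : nat) (M : R -> 'M[R]_(m, n))
    (t : R) (dM : 'M[R]_(m, n)) :
  is_derive t 1 M dM <-> forall i j, is_derive t 1 (fun s => M s i j) (dM i j).
Proof.
split=> [[dM1 <-] i j|H].
  rewrite derive_mx // mxE; apply: DeriveDef => //.
  by have /derivable_mxP := dM1; apply.
have D : derivable M t 1 by apply/derivable_mxP => i j; case: (H i j).
apply: DeriveDef => //; rewrite derive_mx //; apply/matrixP => i j.
by rewrite mxE; case: (H i j).
Qed.

Lemma is_derive_scale (R : realType) (m n : nat) (f : R -> R)
    (M : R -> 'M[R]_(m, n)) (t df : R) (dM : 'M[R]_(m, n)) :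
  is_derive t 1 f df -> is_derive t 1 M dM ->
  is_derive t 1 (fun s => f s *: M s) (df *: M t + f t *: dM).
Proof.
move=> Df /is_derive_mxP DM; apply/is_derive_mxP => i j.
have -> : (fun s => (f s *: M s) i j) = f * (fun s => M s i j).
  by apply/funext => s; rewrite mxE.
apply: is_derive_eq (is_deriveM Df (DM i j)) _.
by rewrite !mxE addrC; congr (_ + _); exact: mulrC.
Qed.

(** The mean value theorem applies on the segment between the two points, which the interval J
    contains. *)
Lemma cst_on_itv (R : realType) (J : set R) (f : R -> R) :
  open J -> is_interval J -> (forall t, J t -> is_derive t 1 f 0) ->
  forall s t, J s -> J t -> f s = f t.
Proof.
move=> oJ iJ df.
suff H s t : J s -> J t -> s < t -> f s = f t.
  move=> s t Js Jt; have [st|ts|->//] := ltgtP s t; first exact: H.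
  by rewrite (H t s).
move=> Js Jt st.
have sub u : s <= u <= t -> J u by apply: iJ.
have [||c _] := @MVT _ f (cst 0) s t st.
- move=> u; rewrite in_itv /= => /andP[su ut]; apply/df/sub.
  by rewrite (ltW su) (ltW ut).
- apply: derivable_within_continuous => u; rewrite in_itv /= => /sub Ju.
  by case: (df u Ju).
- by rewrite /cst mul0r => /eqP; rewrite subr_eq0 eq_sym => /eqP.
Qed.

(** * Cross product and determinant in dimension three *)

(** The indices appear as ring numerals, the form in which [cross] shifts them modulo 3. *)
Lemma I3P (P : 'I_3 -> Prop) : P 0 -> P 1 -> P 2%:R -> forall i, P i.
Proof.
move=> P0 P1 P2 [[|[|[|//]]] lti].
- by have -> : Ordinal lti = 0 by apply: val_inj.
- by have -> : Ordinal lti = 1 by apply: val_inj.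
- by have -> : Ordinal lti = 2%:R by apply: val_inj.
Qed.

Lemma big_I3 (R : realType) (F : 'I_3 -> R) :
  \sum_i F i = F 0 + F 1 + F 2%:R.
Proof.
rewrite !big_ord_recl big_ord0 addr0 addrA; congr (F _ + F _ + F _);
  exact: val_inj.
Qed.

Lemma crossE (R : realType) (v w : 'cV[R]_3) :
  [/\ cross v w 0 0 = v 1 0 * w 2%:R 0 - v 2%:R 0 * w 1 0,
      cross v w 0 1 = v 2%:R 0 * w 0 0 - v 0 0 * w 2%:R 0 &
      cross v w 0 2%:R = v 0 0 * w 1 0 - v 1 0 * w 0 0].
Proof.
have e11 : 1 + 1 = 2%:R :> 'I_3 by apply: val_inj.
have e12 : 1 + 2%:R = 0 :> 'I_3 by apply: val_inj.
have e21 : 2%:R + 1 = 0 :> 'I_3 by apply: val_inj.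
have e22 : 2%:R + 2%:R = 1 :> 'I_3 by apply: val_inj.
by split; rewrite mxE ?add0r ?e11 ?e12 ?e21 ?e22.
Qed.

(** The scalar triple product; it turns every pairing with a row B x B' into a determinant. *)
Lemma cross_mul (R : realType) (u v w : 'cV[R]_3) :
  (cross v w *m u) 0 0 = det3 u v w.
Proof.
rewrite mxE big_I3; have [-> -> ->] := crossE v w.
rewrite /det3 (expand_det_col _ 0) big_I3 !mxE /= /cofactor.
rewrite !(expand_det_row _ ord0) !big_ord_recl !big_ord0 /cofactor.
rewrite !det_mx11 !mxE /=.
(* Entries are read off from the numerical value of the index, so that different expressions for one
   ordinal become the same atom for [ring]. *)
have [f coordE] : exists f : 'cV[R]_3 -> nat -> R,
    forall (z : 'cV[R]_3) (i : 'I_3), z i 0 = f z (val i).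
  by exists (fun z k => z (inord k) 0) => z i; rewrite inord_val.
rewrite !coordE /= /bump /=.
rewrite !expr0 !expr1 /=.
ring.
Qed.

Lemma det3E (R : realType) (u v w : 'cV[R]_3) :
  det3 u v w =
    u 0 0 * (v 1 0 * w 2%:R 0 - v 2%:R 0 * w 1 0)
    + u 1 0 * (v 2%:R 0 * w 0 0 - v 0 0 * w 2%:R 0)
    + u 2%:R 0 * (v 0 0 * w 1 0 - v 1 0 * w 0 0).
Proof.
rewrite -cross_mul mxE big_I3; have [-> -> ->] := crossE v w.
by rewrite ![_ * u _ _]mulrC.
Qed.

(** Cramer's rule: putting the vanishing combination in place of one column multiplies the
    determinant by the coefficient of that column. *)
Lemma det3_free (R : realType) (u v w : 'cV[R]_3) (a b c : R) :
  det3 u v w != 0 -> a *: u + b *: v + c *: w = 0 -> [/\ a = 0, b = 0 & c = 0].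
Proof.
move=> D0 E.
have z0 (x y : 'cV[R]_3) : [/\ det3 0 x y = 0, det3 x 0 y = 0 & det3 x y 0 = 0].
  by split; rewrite det3E !mxE; ring.
have [E1 _ _] := z0 v w; have [_ E2 _] := z0 u w; have [_ _ E3] := z0 u v.
split; apply: (mulIf D0); rewrite mul0r.
- by rewrite -[RHS]E1 -E !det3E !mxE; ring.
- by rewrite -[RHS]E2 -E !det3E !mxE; ring.
- by rewrite -[RHS]E3 -E !det3E !mxE; ring.
Qed.

(** The matrix with columns u, v, w is invertible, and multiplying a row by it lists the three
    pairings. *)
Lemma row3_eq (R : realType) (u v w : 'cV[R]_3) (p q : 'rV[R]_3) :
  det3 u v w != 0 ->
  p *m u = q *m u -> p *m v = q *m v -> p *m w = q *m w -> p = q.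
Proof.
move=> D0 pu pv pw.
set M := (\matrix_(i < 3, j < 3) ([:: u; v; w]`_j) i 0).
have uM : M \in unitmx by rewrite unitmxE unitfE.
have E (j : 'I_3) (z : 'cV[R]_3) : [:: u; v; w]`_j = z -> p *m z = q *m z ->
    (p *m M) 0 j = (q *m M) 0 j.
  move=> <-; have <- : col j M = [:: u; v; w]`_j by apply/colP => i; rewrite !mxE.
  by rewrite colE !mulmxA -!colE => /colP/(_ 0); rewrite mxE [RHS]mxE.
apply: (can_inj (mulmxK uM)); apply/rowP; apply: I3P.
- exact: E pu.
- exact: E pv.
- exact: E pw.
Qed.

(** * Smoothness and Leibniz rules for cross products and determinants *)

Lemma smooth_on_cross (R : realType) (J : set R) (u v : R -> 'cV[R]_3) :
  open J -> smooth_on J u -> smooth_on J v ->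
  smooth_on J (fun t => cross (u t) (v t)).
Proof.
move=> oJ /(smooth_on_mxP u oJ) su /(smooth_on_mxP v oJ) sv.
apply/(smooth_on_mxP _ oJ) => i j.
have := smooth_onB oJ (smooth_onM oJ (su (j + 1) 0) (sv (j + 2%:R) 0))
  (smooth_onM oJ (su (j + 2%:R) 0) (sv (j + 1) 0)).
by apply: eq_smooth_on => // t _; rewrite mxE.
Qed.

Lemma smooth_on_det3 (R : realType) (J : set R) (u v w : R -> 'cV[R]_3) :
  open J -> smooth_on J u -> smooth_on J v -> smooth_on J w ->
  smooth_on J (fun t => det3 (u t) (v t) (w t)).
Proof.
move=> oJ /(smooth_on_mxP u oJ) su sv sw.
have /(smooth_on_mxP _ oJ) sc := smooth_on_cross oJ sv sw.
have := smooth_onD oJ (smooth_onD oJ (smooth_onM oJ (sc 0 0) (su 0 0))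
  (smooth_onM oJ (sc 0 1) (su 1 0))) (smooth_onM oJ (sc 0 2%:R) (su 2%:R 0)).
by apply: eq_smooth_on => // t _; rewrite -cross_mul [RHS]mxE big_I3.
Qed.

Lemma is_derive_cross (R : realType) (u v : R -> 'cV[R]_3) (t : R)
    (du dv : 'cV[R]_3) :
  is_derive t 1 u du -> is_derive t 1 v dv ->
  is_derive t 1 (fun s => cross (u s) (v s)) (cross du (v t) + cross (u t) dv).
Proof.
move=> /is_derive_mxP Du /is_derive_mxP Dv; apply/is_derive_mxP => i j.
have -> : (fun s => cross (u s) (v s) i j) =
    (fun s => u s (j + 1) 0) * (fun s => v s (j + 2%:R) 0)
    - (fun s => u s (j + 2%:R) 0) * (fun s => v s (j + 1) 0).
  by apply/funext => s; rewrite mxE.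
apply: is_derive_eq (is_deriveB (is_deriveM (Du _ _) (Dv _ _))
  (is_deriveM (Du _ _) (Dv _ _))) _.
rewrite !mxE /GRing.scale /=; ring.
Qed.

Lemma is_derive_det3 (R : realType) (u v w : R -> 'cV[R]_3) (t : R)
    (du dv dw : 'cV[R]_3) :
  is_derive t 1 u du -> is_derive t 1 v dv -> is_derive t 1 w dw ->
  is_derive t 1 (fun s => det3 (u s) (v s) (w s))
    (det3 du (v t) (w t) + det3 (u t) dv (w t) + det3 (u t) (v t) dw).
Proof.
move=> Du Dv Dw.
have /is_derive_mxP Dc := is_derive_cross Dv Dw.
move/is_derive_mxP: Du => Du.
have -> : (fun s => det3 (u s) (v s) (w s)) =
    (fun s => cross (v s) (w s) 0 0) * (fun s => u s 0 0)
    + (fun s => cross (v s) (w s) 0 1) * (fun s => u s 1 0)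
    + (fun s => cross (v s) (w s) 0 2%:R) * (fun s => u s 2%:R 0).
  by apply/funext => s; rewrite -cross_mul [LHS]mxE big_I3.
apply: is_derive_eq (is_deriveD (is_deriveD
  (is_deriveM (Dc 0 0) (Du 0 0)) (is_deriveM (Dc 0 1) (Du 1 0)))
  (is_deriveM (Dc 0 2%:R) (Du 2%:R 0))) _.
rewrite /GRing.scale /= ![(_ + _ : 'rV_3) _ _]mxE.
have [-> -> ->] := crossE (v t) (w t); have [-> -> ->] := crossE dv (w t).
have [-> -> ->] := crossE (v t) dw.
by rewrite !det3E; ring.
Qed.

(** * Points of the projective plane and change of lift *)

Lemma vline_scale (K : fieldType) (vT : vectType K) (u v : vT) :
  <[u]>%VS = <[v]>%VS -> exists k, u = k *: v.
Proof. by move=> uv; apply/vlineP; rewrite -uv memv_line. Qed.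

Lemma vlineZ (K : fieldType) (vT : vectType K) (k : K) (v : vT) :
  k != 0 -> <[k *: v]>%VS = <[v]>%VS.
Proof.
move=> k0; apply/eqP; rewrite eqEsubv; apply/andP; split; apply/vlineP.
  by exists k.
by exists k^-1; rewrite scalerA mulVf // scale1r.
Qed.

Lemma open_neq0 (R : realType) (J : set R) (f : R -> R) :
  open J -> smooth_on J f -> open (J `&` [set t | f t != 0]).
Proof.
move=> oJ sf; rewrite openE => t [Jt ft0].
have /derivable1_diffP/differentiable_continuous ct := sf 0%N t Jt.
have nf : \forall s \near t, f s != 0.
  exact: (@cvgr_neq0 _ R _ (nbhs t) _ f (f t) ct ft0).
have nJ : nbhs t J by exact: open_nbhs_nbhs.
by near=> s; split; near: s.
Unshelve. all: by end_near.
Qed.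

(* The arguments on the left are a u, (a u)', (a u)'' when v = u', w = u'',
   b = a' and c = a''. *)
Lemma det3_scaled (R : realType) (a b c : R) (u v w : 'cV[R]_3) :
  det3 (a *: u) (b *: u + a *: v) (c *: u + b *: v + (b *: v + a *: w)) =
  a ^+ 3 * det3 u v w.
Proof. by rewrite !det3E !mxE; ring. Qed.

(** Local convexity provides some local lift V only. Near t the given lift is f V with f smooth and
    nonzero at t, and the determinant is multiplied by the cube of f. *)
Lemma curve_lift_det3_neq0 (R : realType) (I : set R)
    (c : R -> {vspace 'cV[R]_3}) (A : R -> 'cV[R]_3) :
  open I -> locally_convex_curve I c -> curve_lift I c A ->
  forall t, I t -> det3 (A t) (derive1 A t) (derive1n 2 A t) != 0.
Proof.
move=> oI cc [sA cA] t It.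
have [V [[J [oJ Jt [sV cV]]] VD]] := cc t It.
(* A coordinate of V that is nonzero at t stays nonzero nearby, and the ratio of the i-th
   coordinates of A and V is then a smooth formula for f. *)
have [i Vi0] : exists i, V t i 0 != 0.
  have /eqP/colP Vt0 := (cV t Jt).1.
  apply: contrapT => H; apply: Vt0 => i; rewrite mxE.
  by apply/eqP; apply: contrapT => /negP Vi; apply: H; exists i.
have sVi := (smooth_on_mxP V oJ).1 sV i 0.
pose K := I `&` (J `&` [set s | V s i 0 != 0]).
have oK : open K by apply: openI => //; exact: open_neq0.
have Kt : K t by [].
have KI : K `<=` I by move=> s [].
have KJ : K `<=` J by move=> s [_ []].
pose f s := A s i 0 * (V s i 0)^-1.
have sf : smooth_on K f.
  apply: smooth_onM => //.
    by apply: smooth_on_subset KI _; exact: (smooth_on_mxP A oI).1.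
  apply: smooth_onV => //; first by move=> s [_ []].
  exact: smooth_on_subset sVi.
have sVK := smooth_on_subset KJ sV.
have AfV s : K s -> A s = f s *: V s.
  move=> Ks; have [_ [Js Vs0]] := Ks.
  have [k kE] : exists k, A s = k *: V s.
    by apply: vline_scale; rewrite -(cV s Js).2 -(cA s (KI s Ks)).2.
  by rewrite /f kE mxE mulfK.
have A1 s : K s -> derive1 A s = derive1 f s *: V s + f s *: derive1 V s.
  move=> Ks; apply: etrans (eq_derive1 oK AfV Ks) _.
  apply: is_derive1_derive1; apply: is_derive_scale.
    exact: (smooth_on_is_derive 0 sf).
  exact: (smooth_on_is_derive 0 sVK).
have A2 : derive1n 2 A t = derive1n 2 f t *: V t + derive1 f t *: derive1 V t
    + (derive1 f t *: derive1 V t + f t *: derive1n 2 V t).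
  apply: etrans (eq_derive1 oK A1 Kt) _.
  apply: is_derive1_derive1; apply: is_deriveD; apply: is_derive_scale.
  - exact: (smooth_on_is_derive 1 sf).
  - exact: (smooth_on_is_derive 0 sVK).
  - exact: (smooth_on_is_derive 0 sf).
  - exact: (smooth_on_is_derive 1 sVK).
rewrite A2 A1 // AfV // det3_scaled mulf_neq0 // expf_neq0 //.
apply/eqP => ft0; have := (cA t It).1.
by rewrite AfV // ft0 scale0r eqxx.
Qed.

(** * The moving frame of a curve in Laguerre-Forsyth form *)

(** Since A''' = - r A, the frame (A, A', A'') is closed under differentiation: c A''' contributes -
    c r to the coefficient of A. *)
Lemma LF_frame_derive (R : realType) (I : set R) (A F : R -> 'cV[R]_3)
    (r a b c : R -> R) :
  open I -> smooth_on I A -> LF_ode I A r ->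
  smooth_on I a -> smooth_on I b -> smooth_on I c ->
  (forall t, I t -> F t = a t *: A t + b t *: derive1 A t + c t *: derive1n 2 A t) ->
  forall t, I t ->
    derive1 F t = (derive1 a t - c t * r t) *: A t
      + (a t + derive1 b t) *: derive1 A t + (b t + derive1 c t) *: derive1n 2 A t.
Proof.
move=> oI sA LF sa sb sc FE t It.
apply: etrans (eq_derive1 oI FE It) _.
have A3 : derive1n 3 A t = - (r t *: A t) by apply/eqP; rewrite -addr_eq0 LF.
have dA0 : is_derive t 1 A (derive1 A t) := smooth_on_is_derive 0 sA It.
have dA1 : is_derive t 1 (derive1 A) (derive1n 2 A t) := smooth_on_is_derive 1 sA It.
have dA2 : is_derive t 1 (derive1n 2 A) (derive1n 3 A t) := smooth_on_is_derive 2 sA It.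
have da : is_derive t 1 a (derive1 a t) := smooth_on_is_derive 0 sa It.
have db : is_derive t 1 b (derive1 b t) := smooth_on_is_derive 0 sb It.
have dc : is_derive t 1 c (derive1 c t) := smooth_on_is_derive 0 sc It.
apply: etrans (is_derive1_derive1 (is_deriveD
  (is_deriveD (is_derive_scale da dA0) (is_derive_scale db dA1))
  (is_derive_scale dc dA2))) _.
by rewrite A3; apply/colP => i; rewrite !mxE; ring.
Qed.

(** By the Leibniz rule, each term of the derivative has two proportional columns. The factor l is
    left free so that the lemma serves both A, with l = - r, and the normalized B. *)
Lemma det3_LF_cst (R : realType) (I : set R) (A : R -> 'cV[R]_3) :
  open I -> is_interval I -> smooth_on I A ->
  (forall t, I t -> exists l : R, derive1n 3 A t = l *: A t) ->
  forall s t, I s -> I t ->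
    det3 (A s) (derive1 A s) (derive1n 2 A s) =
    det3 (A t) (derive1 A t) (derive1n 2 A t).
Proof.
move=> oI iI sA LF.
apply: (@cst_on_itv _ I (fun t => det3 (A t) (derive1 A t) (derive1n 2 A t))) => //.
move=> t It; have dA n := @smooth_on_is_derive _ _ _ _ n t sA It.
apply: is_derive_eq (is_derive_det3 (dA 0%N) (dA 1%N) (dA 2%N)) _.
by have [l ->] := LF t It; rewrite !det3E !mxE; ring.
Qed.

(** The real power is applied to |c|, where exponents multiply; the sign of c is its own cube. *)
Lemma cube_root (R : realType) (c : R) : exists k, k ^+ 3 = c.
Proof.
exists (Num.sg c * (`|c| `^ 3^-1)).
rewrite exprMn -[(_ `^ _) ^+ 3]powR_mulrn ?powR_ge0 // -powRrM mulVf ?pnatr_eq0 //.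
by rewrite powRr1 // exprSr expr2 -mulrA -numEsg; have [->|c0] := eqVneq c 0;
  rewrite ?mulr0 // -expr2 sqr_sg c0 mul1r.
Qed.

(** * The dancing equation for rescaled lifts, at a point *)

(** The variables with indices 1 and 2 stand for derivatives; the left side is (g B x B')' without
    the zero term B' x B'. Pairing with A gives the first equation and pairing with B' the second,
    while both sides vanish on B, a combination of A and A'. *)
Lemma dancing_scaling (R : realType) (A A1 A2 B B1 B2 : 'cV[R]_3)
    (x y x1 y1 p q f f1 g g1 : R) :
  B = x *: A + y *: A1 ->
  B1 = x1 *: A + (x + y1) *: A1 + y *: A2 ->
  B2 = p *: A + q *: A1 + (x + 2%:R * y1) *: A2 ->
  y != 0 -> det3 A A1 A2 != 0 ->
  g1 *: cross B B1 + g *: cross B B2 = cross (f *: A) (f1 *: A + f *: A1) <->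
  g1 * y + g * (x + 2%:R * y1) = 0 /\
  - (g * det3 B B1 B2) = f ^+ 2 * (y * det3 A A1 A2).
Proof.
move=> BE B1E B2E y0 D0; set D := det3 A A1 A2 in D0 *.
have pairL (w : 'cV[R]_3) :
    ((g1 *: cross B B1 + g *: cross B B2) *m w) 0 0 =
    g1 * det3 w B B1 + g * det3 w B B2.
  by rewrite mulmxDl -!scalemxAl mxE [X in X + _]mxE [X in _ + X]mxE !cross_mul.
have pairR (w : 'cV[R]_3) :
    (cross (f *: A) (f1 *: A + f *: A1) *m w) 0 0 = f ^+ 2 * det3 w A A1.
  by rewrite cross_mul !det3E !mxE; ring.
have L_A : g1 * det3 A B B1 + g * det3 A B B2 =
    (g1 * y + g * (x + 2%:R * y1)) * (y * D).
  by rewrite BE B1E B2E /D !det3E !mxE; ring.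
have R_A : det3 A A A1 = 0 by rewrite det3E; ring.
have L_B1 : g1 * det3 B1 B B1 + g * det3 B1 B B2 = - (g * det3 B B1 B2).
  by rewrite !det3E; ring.
have R_B1 : det3 B1 A A1 = y * D by rewrite B1E /D !det3E !mxE; ring.
split=> [E|[E1 E2]].
  have EA : (g1 * y + g * (x + 2%:R * y1)) * (y * D) = 0.
    by rewrite -L_A -pairL E pairR R_A mulr0.
  split; last by rewrite -L_B1 -pairL E pairR R_B1.
  by move/eqP: EA; rewrite mulf_eq0 (negPf (mulf_neq0 y0 D0)) orbF => /eqP.
have mx11 (M N : 'M[R]_1) : M 0 0 = N 0 0 -> M = N.
  by move=> MN; rewrite [M]mx11_scalar [N]mx11_scalar MN.
(* The three test vectors form a basis, as det(A, B, B') = y^2 D. *)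
apply: (@row3_eq _ A B B1).
- have -> : det3 A B B1 = y ^+ 2 * D by rewrite BE B1E /D !det3E !mxE; ring.
  by rewrite mulf_neq0 // expf_neq0.
- by apply: mx11; rewrite pairL pairR L_A R_A E1 mul0r mulr0.
- apply: mx11; rewrite pairL pairR.
  by rewrite BE !det3E !mxE; ring.
- by apply: mx11; rewrite pairL pairR L_B1 R_B1.
Qed.

(** * Derivatives of B = x A + y A' and smoothness of its coefficients *)

(** Three applications of [LF_frame_derive]. In B''' the coefficient of A'' is 3 (x' + y''), which
    must vanish when B''' is proportional to B. *)
Lemma LF_comb_derive (R : realType) (I : set R) (A B : R -> 'cV[R]_3)
    (r x y : R -> R) :
  open I -> smooth_on I A -> LF_ode I A r ->
  smooth_on I r -> smooth_on I x -> smooth_on I y ->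
  (forall t, I t -> B t = x t *: A t + y t *: derive1 A t) ->
  forall t, I t ->
  [/\ derive1 B t = derive1 x t *: A t + (x t + derive1 y t) *: derive1 A t
        + y t *: derive1n 2 A t,
      derive1n 2 B t = (derive1n 2 x t - y t * r t) *: A t
        + (2%:R * derive1 x t + derive1n 2 y t) *: derive1 A t
        + (x t + 2%:R * derive1 y t) *: derive1n 2 A t &
      derive1n 3 B t =
        (derive1n 3 x t - (derive1 y t * r t + y t * derive1 r t)
          - (x t + 2%:R * derive1 y t) * r t) *: A t
        + (3%:R * derive1n 2 x t + derive1n 3 y t - y t * r t) *: derive1 A t
        + (3%:R * (derive1 x t + derive1n 2 y t)) *: derive1n 2 A t].
Proof.
move=> oI sA LF sr sx sy BE.
have sx1 := smooth_on_derive1 sx; have sy1 := smooth_on_derive1 sy.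
have sx2 := smooth_on_derive1 sx1; have sy2 := smooth_on_derive1 sy1.
have s2 : smooth_on I (cst (2%:R : R)) := @smooth_on_cst _ _ I _.
have dr t (It : I t) : is_derive t 1 r (derive1 r t) := smooth_on_is_derive 0 sr It.
have dx t (It : I t) : is_derive t 1 x (derive1 x t) := smooth_on_is_derive 0 sx It.
have dx1 t (It : I t) : is_derive t 1 (derive1 x) (derive1n 2 x t) :=
  smooth_on_is_derive 1 sx It.
have dx2 t (It : I t) : is_derive t 1 (derive1n 2 x) (derive1n 3 x t) :=
  smooth_on_is_derive 2 sx It.
have dy t (It : I t) : is_derive t 1 y (derive1 y t) := smooth_on_is_derive 0 sy It.
have dy1 t (It : I t) : is_derive t 1 (derive1 y) (derive1n 2 y t) :=
  smooth_on_is_derive 1 sy It.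
have dy2 t (It : I t) : is_derive t 1 (derive1n 2 y) (derive1n 3 y t) :=
  smooth_on_is_derive 2 sy It.
have B1 t : I t -> derive1 B t = derive1 x t *: A t
    + (x t + derive1 y t) *: derive1 A t + y t *: derive1n 2 A t.
  move=> It; have BE0 s : I s -> B s = x s *: A s + y s *: derive1 A s
      + (cst 0 : R -> R) s *: derive1n 2 A s.
    by move=> Is; rewrite BE // scale0r addr0.
  rewrite (LF_frame_derive oI sA LF sx sy (@smooth_on_cst _ _ I 0) BE0 It).
  by rewrite derive1_cst mul0r subr0 addr0.
have B2 t : I t -> derive1n 2 B t = (derive1n 2 x t - y t * r t) *: A t
    + (2%:R * derive1 x t + derive1n 2 y t) *: derive1 A t
    + (x t + 2%:R * derive1 y t) *: derive1n 2 A t.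
  move=> It; have sxy := smooth_onD oI sx sy1.
  apply: etrans (LF_frame_derive oI sA LF sx1 sxy sy B1 It) _.
  rewrite (is_derive1_derive1 (is_deriveD (dx t It) (dy1 t It))).
  by congr (_ *: _ + _ *: _ + _ *: _); ring.
move=> t It; split; [exact: B1|exact: B2|].
have sa := smooth_onB oI sx2 (smooth_onM oI sy sr).
have sb := smooth_onD oI (smooth_onM oI s2 sx1) sy2.
have sc := smooth_onD oI sx (smooth_onM oI s2 sy1).
have d2 (f : R -> R) (df : R) : is_derive t 1 f df ->
    is_derive t 1 (fun s => 2%:R * f s) (2%:R * df) by exact: is_deriveZ.
have ea : derive1 (fun s => derive1n 2 x s - y s * r s) t =
    derive1n 3 x t - (y t * derive1 r t + r t * derive1 y t).
  by apply: is_derive1_derive1; apply: is_deriveB;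
    [exact: dx2|exact: is_deriveM (dy t It) (dr t It)].
have eb : derive1 (fun s => 2%:R * derive1 x s + derive1n 2 y s) t =
    2%:R * derive1n 2 x t + derive1n 3 y t.
  by apply: is_derive1_derive1; apply: is_deriveD;
    [exact: d2 (dx1 t It)|exact: dy2].
have ec : derive1 (fun s => x s + 2%:R * derive1 y s) t =
    derive1 x t + 2%:R * derive1n 2 y t.
  by apply: is_derive1_derive1; apply: is_deriveD;
    [exact: dx|exact: d2 (dy1 t It)].
rewrite [LHS](LF_frame_derive oI sA LF
  (sa : smooth_on I (fun s => derive1n 2 x s - y s * r s))
  (sb : smooth_on I (fun s => 2%:R * derive1 x s + derive1n 2 y s))
  (sc : smooth_on I (fun s => x s + 2%:R * derive1 y s)) B2 It).
rewrite ea eb ec.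
move: (derive1n 3 x t) (derive1n 3 y t) (derive1n 2 x t) (derive1n 2 y t).
move: (derive1 x t) (derive1 y t) (derive1 r t) => x1 y1 r1 x3 y3 x2 y2.
by congr (_ *: _ + _ *: _ + _ *: _); ring.
Qed.

(** The quotient is given by f h = g, which suits functions known only through a linear equation. *)
Lemma smooth_on_ratio (R : realType) (J : set R) (f g h : R -> R) :
  open J -> smooth_on J g -> smooth_on J h ->
  (forall t, J t -> h t != 0) -> (forall t, J t -> f t * h t = g t) ->
  smooth_on J f.
Proof.
move=> oJ sg sh h0 fE.
have := smooth_onM oJ sg (smooth_onV oJ h0 sh).
by apply: eq_smooth_on => // t Jt; rewrite -fE // mulfK ?h0.
Qed.

(** Cramer's rule in the frame (A, A', A'') expresses r, x and y as quotients of smooth determinants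
    by D. *)
Lemma LF_coef_smooth (R : realType) (I : set R) (A B : R -> 'cV[R]_3)
    (r x y : R -> R) :
  open I -> smooth_on I A -> smooth_on I B -> LF_ode I A r ->
  (forall t, I t -> det3 (A t) (derive1 A t) (derive1n 2 A t) != 0) ->
  (forall t, I t -> B t = x t *: A t + y t *: derive1 A t) ->
  [/\ smooth_on I r, smooth_on I x & smooth_on I y].
Proof.
move=> oI sA sB LF D0 BE.
have sA1 := smooth_on_derive1 sA; have sA2 := smooth_on_derive1n (n := 2%N) sA.
have sA3 := smooth_on_derive1n (n := 3%N) sA.
have sD := smooth_on_det3 oI sA sA1 sA2.
split.
(* Swapping A' and A'' absorbs the sign in A''' = - r A. *)
- apply: (smooth_on_ratio oI (smooth_on_det3 oI sA3 sA2 sA1) sD D0) => t It.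
  have -> : derive1n 3 A t = - (r t *: A t) by apply/eqP; rewrite -addr_eq0 LF.
  move: (A t) (derive1 A t) (derive1n 2 A t) => u v w.
  by rewrite !det3E !mxE; ring.
- apply: (smooth_on_ratio oI (smooth_on_det3 oI sB sA1 sA2) sD D0) => t It.
  rewrite BE //; move: (A t) (derive1 A t) (derive1n 2 A t) => u v w.
  by rewrite !det3E !mxE; ring.
- apply: (smooth_on_ratio oI (smooth_on_det3 oI sA sB sA2) sD D0) => t It.
  rewrite BE //; move: (A t) (derive1 A t) (derive1n 2 A t) => u v w.
  by rewrite !det3E !mxE; ring.
Qed.

(** * The dancing equation along the curve *)

Lemma dancing_scaling_on (R : realType) (I : set R) (A B : R -> 'cV[R]_3)
    (r x y f g : R -> R) :
  open I -> smooth_on I A -> smooth_on I B -> LF_ode I A r ->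
  smooth_on I r -> smooth_on I x -> smooth_on I y ->
  smooth_on I f -> smooth_on I g ->
  (forall t, I t -> B t = x t *: A t + y t *: derive1 A t) ->
  forall t, I t -> y t != 0 ->
  det3 (A t) (derive1 A t) (derive1n 2 A t) != 0 ->
  derive1 (fun s => g s *: cross (B s) (derive1 B s)) t =
    cross (f t *: A t) (derive1 (fun s => f s *: A s) t) <->
  derive1 g t * y t + g t * (x t + 2%:R * derive1 y t) = 0 /\
  - (g t * det3 (B t) (derive1 B t) (derive1n 2 B t)) =
    f t ^+ 2 * (y t * det3 (A t) (derive1 A t) (derive1n 2 A t)).
Proof.
move=> oI sA sB LF sr sx sy sf sg BE t It y0 D0.
have [B1 B2 _] := LF_comb_derive oI sA LF sr sx sy BE It.
have dB : is_derive t 1 B (derive1 B t) := smooth_on_is_derive 0 sB It.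
have dB1 : is_derive t 1 (derive1 B) (derive1n 2 B t) := smooth_on_is_derive 1 sB It.
have dg : is_derive t 1 g (derive1 g t) := smooth_on_is_derive 0 sg It.
have df : is_derive t 1 f (derive1 f t) := smooth_on_is_derive 0 sf It.
have dA : is_derive t 1 A (derive1 A t) := smooth_on_is_derive 0 sA It.
rewrite (is_derive1_derive1 (is_derive_scale df dA)).
rewrite (is_derive1_derive1 (is_derive_scale dg (is_derive_cross dB dB1))).
have -> : cross (derive1 B t) (derive1 B t) = 0.
  by apply/rowP => i; rewrite !mxE mulrC subrr.
rewrite add0r; exact: dancing_scaling (BE t It) B1 B2 y0 D0.
Qed.

(** Differentiation gives 3 h^2 h' = 0, and h cannot vanish because its cube is c. *)
Lemma cube_cst_derive0 (R : realType) (I : set R) (h : R -> R) (c : R) :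
  open I -> smooth_on I h -> c != 0 -> (forall t, I t -> h t ^+ 3 = c) ->
  forall t, I t -> derive1 h t = 0.
Proof.
move=> oI sh c0 hc t It.
have dh : is_derive t 1 h (derive1 h t) := smooth_on_is_derive 0 sh It.
have E s : I s -> h s * (h s * h s) = cst c s.
  by move=> Is; rewrite -(hc s Is) !exprS expr0 mulr1.
have H : h t * (h t * derive1 h t + h t * derive1 h t) + h t * h t * derive1 h t = 0.
  rewrite -[RHS](derive1_cst c t) -(eq_derive1 oI E It).
  exact/esym/is_derive1_derive1/(is_deriveM dh (is_deriveM dh dh)).
have h0 : h t != 0 by apply: contraNneq c0 => ht; rewrite -(hc t It) ht expr0n.
have : 3%:R * (h t ^+ 2 * derive1 h t) = 0 by rewrite -[RHS]H expr2; ring.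
move/eqP; rewrite mulf_eq0 pnatr_eq0 /= mulf_eq0 expf_eq0 /= (negPf h0) /=.
by move/eqP.
Qed.

(** By [cross_mul] the left side is the pairing of B x B' with A, which the condition p q = 1
    normalizes. *)
Lemma involute_pairing (R : realType) (A A1 A2 B B1 : 'cV[R]_3) (x y x1 y1 : R) :
  B = x *: A + y *: A1 -> B1 = x1 *: A + (x + y1) *: A1 + y *: A2 ->
  det3 A B B1 = y ^+ 2 * det3 A A1 A2.
Proof. by move=> -> ->; rewrite !det3E !mxE; ring. Qed.

(** * The two implications of the dancing criterion *)

Lemma dancing_mate_sum0 (R : realType) (I : set R) (A B : R -> 'cV[R]_3)
    (r x y : R -> R) :
  open I -> is_interval I -> smooth_on I A -> smooth_on I B -> LF_ode I A r ->
  (forall t, I t -> det3 (A t) (derive1 A t) (derive1n 2 A t) != 0) ->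
  (forall t, I t -> det3 (B t) (derive1 B t) (derive1n 2 B t) != 0) ->
  (forall t, I t -> y t != 0) ->
  (forall t, I t -> B t = x t *: A t + y t *: derive1 A t) ->
  (forall t, I t -> exists l : R, derive1n 3 B t = l *: B t) ->
  dancing_mate I (fun t => <[A t]>%VS)
    (fun t => <[cross (B t) (derive1 B t)]>%VS) ->
  forall t, I t -> x t + derive1 y t = 0.
Proof.
move=> oI iI sA sB LF D0 W0 y0 BE BN [qq [pp [sqq spp H]]] t It.
have [sr sx sy] := LF_coef_smooth oI sA sB LF D0 BE.
have LFA s : I s -> exists l : R, derive1n 3 A s = l *: A s.
  by move=> Is; exists (- r s); apply/eqP; rewrite scaleNr -addr_eq0 LF.
have [D DE] : exists D, forall s, I s -> det3 (A s) (derive1 A s) (derive1n 2 A s) = D.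
  by eexists=> s Is; exact: (det3_LF_cst oI iI sA LFA Is It).
have [W WE] : exists W, forall s, I s -> det3 (B s) (derive1 B s) (derive1n 2 B s) = W.
  by eexists=> s Is; exact: (det3_LF_cst oI iI sB BN Is It).
have D0' : D != 0 by rewrite -(DE t It); exact: D0.
have W0' : W != 0 by rewrite -(WE t It); exact: W0.
pose b s := cross (B s) (derive1 B s).
have bA s : I s -> (b s *m A s) 0 0 = y s ^+ 2 * D.
  move=> Is; rewrite cross_mul -(DE s Is).
  by have [B1 _ _] := LF_comb_derive oI sA LF sr sx sy BE Is;
    exact: involute_pairing (BE s Is) B1.
(* Equality of projective points gives the multipliers pointwise; their relation is p q = 1. *)
have fg s : I s -> exists k l, [/\ qq s = k *: A s, pp s = l *: b s &
    l * k * (y s ^+ 2 * D) = 1].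
  move=> Is; have [q_s p_s pq _] := H s Is.
  have [k kE] := vline_scale (esym q_s); have [l lE] := vline_scale (esym p_s).
  exists k, l; split=> //; rewrite -(bA s Is).
  move: pq; rewrite kE lE -scalemxAl -scalemxAr scalerA => /matrixP/(_ 0 0).
  by rewrite mxE [RHS]mxE.
have sy2 := smooth_onM oI sy sy.
have sy2D := smooth_onM oI sy2 (@smooth_on_cst _ _ I D).
have y2D0 s : I s -> y s * y s * D != 0 
  by move=> Is; exact: mulf_neq0 (mulf_neq0 (y0 s Is) (y0 s Is)) D0'.
(* The multipliers chosen pointwise carry no regularity. Pairing [pp] with A and b with [qq], then
   dividing by b A = y^2 D, recovers them by smooth formulas. *)
pose g s := (pp s *m A s) 0 0 / (y s * y s * D).
pose f s := (b s *m qq s) 0 0 / (y s * y s * D).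
have fE s : I s -> qq s = f s *: A s.
  move=> Is; have [k [l [kE _ _]]] := fg s Is.
  rewrite /f kE -scalemxAr mxE bA // expr2 mulfK //; exact: y2D0.
have gE s : I s -> pp s = g s *: b s.
  move=> Is; have [k [l [_ lE _]]] := fg s Is.
  rewrite /g lE -scalemxAl mxE bA // expr2 mulfK //; exact: y2D0.
have fgE s : I s -> g s * f s * (y s ^+ 2 * D) = 1.
  move=> Is; have [k [l [kE lE <-]]] := fg s Is.
  have -> : f s = k by rewrite /f kE -scalemxAr mxE bA // expr2 mulfK //; exact: y2D0.
  by rewrite /g lE -scalemxAl mxE bA // expr2 mulfK //; exact: y2D0.
have sB1 := smooth_on_derive1 sB.
have sf : smooth_on I f.
  apply: (smooth_on_ratio oI (smooth_on_det3 oI sqq sB sB1) sy2D y2D0) => s Is.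
  by rewrite -cross_mul mulfVK //; exact: y2D0.
have sb : smooth_on I b := smooth_on_cross oI sB sB1.
have sg : smooth_on I g.
  have spq : smooth_on I (fun s => (pp s *m A s) 0 0).
    have spp' j := (smooth_on_mxP pp oI).1 spp 0 j.
    have sA' j := (smooth_on_mxP A oI).1 sA j 0.
    have := smooth_onD oI (smooth_onD oI (smooth_onM oI (spp' 0) (sA' 0))
      (smooth_onM oI (spp' 1) (sA' 1))) (smooth_onM oI (spp' 2%:R) (sA' 2%:R)).
    by apply: eq_smooth_on => // s _; rewrite [RHS]mxE big_I3.
  apply: (smooth_on_ratio oI spq sy2D y2D0) => s Is.
  by rewrite mulfVK //; exact: y2D0.
have E s : I s -> derive1 g s * y s + g s * (x s + 2%:R * derive1 y s) = 0 /\
    - (g s * W) = f s ^+ 2 * (y s * D).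
  move=> Is; rewrite -(DE s Is) -(WE s Is).
  apply/(dancing_scaling_on oI sA sB LF sr sx sy sf sg BE Is (y0 s Is) (D0 s Is)).
  have [_ _ _ ppE] := H s Is.
  rewrite -(eq_derive1 oI gE Is) ppE.
  by rewrite (eq_derive1 oI fE Is) fE.
have WD0 : - (W * D) != 0 by rewrite oppr_eq0 mulf_neq0.
have gy3 s : I s -> (g s * y s) ^+ 3 = (- (W * D))^-1.
  move=> Is; apply: (mulIf WD0); rewrite mulVf //.
  have [_ E2] := E s Is; have fg1 := fgE s Is.
  (* By the second equation this product is (f g y^2 D)^2 = 1. *)
  transitivity (- (g s * W) * (g s ^+ 2 * y s ^+ 3 * D)); first by ring.
  by rewrite E2 -[RHS](expr1n _ 2) -fg1; ring.
have gy0 := cube_cst_derive0 oI (smooth_onM oI sg sy) (invr_neq0 WD0) gy3 It.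
have dg : is_derive t 1 g (derive1 g t) := smooth_on_is_derive 0 sg It.
have dy : is_derive t 1 y (derive1 y t) := smooth_on_is_derive 0 sy It.
have gy1 : g t * derive1 y t + y t * derive1 g t = 0.
  by rewrite -gy0; apply/esym; exact: is_derive1_derive1 (is_deriveM dg dy).
have g0 : g t != 0.
  apply/eqP => g0; have := fgE t It; rewrite g0 !mul0r => /esym/eqP.
  by rewrite oner_eq0.
(* Subtracting (g y)' = 0 from the first equation leaves g (x + y') = 0. *)
apply: (mulfI g0); rewrite mulr0.
have [E1 _] := E t It; rewrite -[RHS](subrr 0) -{1}E1 -gy1; ring.
Qed.

Lemma sum0_dancing_mate (R : realType) (I : set R) (A B : R -> 'cV[R]_3)
    (r x y : R -> R) :
  open I -> is_interval I -> smooth_on I A -> smooth_on I B -> LF_ode I A r ->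
  (forall t, I t -> det3 (A t) (derive1 A t) (derive1n 2 A t) != 0) ->
  (forall t, I t -> det3 (B t) (derive1 B t) (derive1n 2 B t) != 0) ->
  (forall t, I t -> y t != 0) ->
  (forall t, I t -> B t = x t *: A t + y t *: derive1 A t) ->
  (forall t, I t -> exists l : R, derive1n 3 B t = l *: B t) ->
  I !=set0 ->
  (forall t, I t -> x t + derive1 y t = 0) ->
  dancing_mate I (fun t => <[A t]>%VS)
    (fun t => <[cross (B t) (derive1 B t)]>%VS).
Proof.
move=> oI iI sA sB LF D0 W0 y0 BE BN [t It] xy0.
have [sr sx sy] := LF_coef_smooth oI sA sB LF D0 BE.
have LFA s : I s -> exists l : R, derive1n 3 A s = l *: A s.
  by move=> Is; exists (- r s); apply/eqP; rewrite scaleNr -addr_eq0 LF.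
have [D DE] : exists D, forall s, I s -> det3 (A s) (derive1 A s) (derive1n 2 A s) = D.
  by eexists=> s Is; exact: (det3_LF_cst oI iI sA LFA Is It).
have [W WE] : exists W, forall s, I s -> det3 (B s) (derive1 B s) (derive1n 2 B s) = W.
  by eexists=> s Is; exact: (det3_LF_cst oI iI sB BN Is It).
have D0' : D != 0 by rewrite -(DE t It); exact: D0.
have W0' : W != 0 by rewrite -(WE t It); exact: W0.
have WD0 : - (W * D) != 0 by rewrite oppr_eq0 mulf_neq0.
have [k kE] := cube_root (- (W * D))^-1.
have k0 : k != 0.
  by apply/eqP => k0; move: kE (invr_neq0 WD0) => <-; rewrite k0 expr0n eqxx.
(* The first equation makes g y constant, and f is then forced by f g y^2 D = 1. *)
pose g s := k * (y s)^-1; pose f s := (k * D)^-1 * (y s)^-1.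
have sV := smooth_onV oI y0 sy.
have sg : smooth_on I g := smooth_onM oI (@smooth_on_cst _ _ I k) sV.
have sf : smooth_on I f := smooth_onM oI (@smooth_on_cst _ _ I (k * D)^-1) sV.
exists (fun s => f s *: A s), (fun s => g s *: cross (B s) (derive1 B s)).
split.
- exact: smooth_onZ oI sf sA.
- exact: smooth_onZ oI sg (smooth_on_cross oI sB (smooth_on_derive1 sB)).
move=> s Is.
have y0s := y0 s Is.
have f0 : f s != 0 by rewrite mulf_neq0 ?invr_neq0 // mulf_neq0.
have g0 : g s != 0 by rewrite mulf_neq0 ?invr_neq0.
split.
- by rewrite vlineZ.
- by rewrite vlineZ.
- have [B1 _ _] := LF_comb_derive oI sA LF sr sx sy BE Is.
  rewrite -scalemxAl -scalemxAr scalerA; apply/matrixP => i j; rewrite !ord1.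
  rewrite mxE cross_mul (involute_pairing (BE s Is) B1) DE // [RHS]mxE eqxx mulr1n.
  by rewrite /g /f; field; rewrite D0' k0 y0s.
apply/(dancing_scaling_on oI sA sB LF sr sx sy sf sg BE Is y0s (D0 s Is)).
rewrite DE // WE //; split.
  have dg : is_derive s 1 g (derive1 g s) := smooth_on_is_derive 0 sg Is.
  have dy : is_derive s 1 y (derive1 y s) := smooth_on_is_derive 0 sy Is.
  have gy u : I u -> g u * y u = cst k u by move=> Iu; rewrite /g mulfVK ?y0.
  have gy1 : g s * derive1 y s + y s * derive1 g s = 0.
    rewrite -[RHS](derive1_cst k s) -(eq_derive1 oI gy Is).
    by apply/esym; exact: is_derive1_derive1 (is_deriveM dg dy).
  (* The left side is (g y)' + g (x + y'). *)
  by rewrite -[RHS]addr0 -{1}gy1 -[in RHS](mulr0 (g s)) -(xy0 s Is); ring.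
have k3 : k ^+ 3 * W * D = - 1.
  by rewrite kE invrN -mulrA mulNr mulVf // mulf_neq0.
rewrite /g /f.
have -> : ((k * D)^-1 / y s) ^+ 2 * (y s * D) = (k ^+ 2 * D * y s)^-1.
  by field; rewrite D0' k0 y0s.
(* After this multiplication the second equation reads - k^3 W D = 1, which is the choice of k. *)
apply: (mulIf (_ : k ^+ 2 * D * y s != 0)); first by rewrite !mulf_neq0 // expf_neq0.
rewrite mulVf; last by rewrite !mulf_neq0 // expf_neq0.
transitivity (- (k ^+ 3 * W * D)); last by rewrite k3 opprK.
by field.
Qed.

(** * The differential equations of a normalized involute *)

(** In B''' = l B the A'' coefficient gives x' + y'' = 0. The A and A' coefficients both determine
    l; eliminating it and replacing x'' and x''' by - y''' and - y'''' gives the equation of order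
    four. *)
Lemma normalized_involute_eqs (R : realType) (I : set R)
    (A B : R -> 'cV[R]_3) (r x y : R -> R) :
  open I -> smooth_on I A -> LF_ode I A r ->
  smooth_on I r -> smooth_on I x -> smooth_on I y ->
  (forall t, I t -> det3 (A t) (derive1 A t) (derive1n 2 A t) != 0) ->
  (forall t, I t -> y t != 0) ->
  (forall t, I t -> B t = x t *: A t + y t *: derive1 A t) ->
  (forall t, I t -> exists l : R, derive1n 3 B t = l *: B t) ->
  forall t, I t ->
    derive1 x t + derive1n 2 y t = 0 /\
    derive1n 4 y t - 2%:R * (derive1n 3 y t * x t / y t)
      + 3%:R * r t * derive1 y t + derive1 r t * y t = 0.
Proof.
move=> oI sA LF sr sx sy D0 y0 BE BN.
have eqs t : I t -> derive1 x t + derive1n 2 y t = 0 /\ exists l : R,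
    derive1n 3 x t - (derive1 y t * r t + y t * derive1 r t)
      - (x t + 2%:R * derive1 y t) * r t = l * x t /\
    3%:R * derive1n 2 x t + derive1n 3 y t - y t * r t = l * y t.
  move=> It; have [l B3l] := BN t It.
  have [_ _] := LF_comb_derive oI sA LF sr sx sy BE It.
  rewrite B3l BE // => E.
  have comb0 (a b c k m : R) (u v w : 'cV[R]_3) :
      l *: (k *: u + m *: v) = a *: u + b *: v + c *: w ->
      (a - l * k) *: u + (b - l * m) *: v + c *: w = 0.
    move=> lE; rewrite !scalerBl -!scalerA addrACA -opprD -scalerDr.
    by rewrite lE -(addrA (_ + _)) (addrC (- _)) addrA subrr.
  have [a0 b0 c0] := det3_free (D0 t It) (comb0 _ _ _ _ _ _ _ _ E).
  split; last by exists l; split; apply/subr0_eq.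
  by apply/eqP; move/eqP: c0; rewrite mulf_eq0 pnatr_eq0.
have x1E t : I t -> derive1 x t = - derive1n 2 y t.
  by move=> It; apply/eqP; rewrite -addr_eq0 (eqs t It).1.
have x2E t : I t -> derive1n 2 x t = - derive1n 3 y t.
  move=> It; apply: etrans (eq_derive1 oI x1E It) _.
  exact: is_derive1_derive1 (is_deriveN (smooth_on_is_derive 2 sy It)).
have x3E t : I t -> derive1n 3 x t = - derive1n 4 y t.
  move=> It; apply: etrans (eq_derive1 oI x2E It) _.
  exact: is_derive1_derive1 (is_deriveN (smooth_on_is_derive 3 sy It)).
move=> t It; have [x1y2 [l [E1 E2]]] := eqs t It; split=> //.
have y0t := y0 t It; move: E1 E2; rewrite x3E // x2E //.
move: (derive1n 4 y t) (derive1n 3 y t) (derive1 y t) (derive1 r t) => y4 y3 y1 r1.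
move: (x t) (y t) (r t) y0t => X Y r0 Y0 E1 E2.
(* The elimination of l: x times the A' coefficient minus y times the A coefficient, divided by
   y. *)
have -> : y4 - 2%:R * (y3 * X / Y) + 3%:R * r0 * y1 + r1 * Y =
    (X * (3%:R * - y3 + y3 - Y * r0)
     - Y * (- y4 - (y1 * r0 + Y * r1) - (X + 2%:R * y1) * r0)) / Y by field.
by rewrite E1 E2 (_ : _ - _ = 0) ?mul0r //; ring.
Qed.

(** * The theorem, assembled from the equations and the two implications *)

Theorem proposition5p12 (R : realType) (I : set R)
  (gamma invol : R -> {vspace 'cV[R]_3}) (A B : R -> 'cV[R]_3) (r x y : R -> R)
  (I_open : open I) (I_itv : is_interval I) (I_neq0 : I !=set0)
  (gamma_convex : locally_convex_curve I gamma)
  (A_lift : curve_lift I gamma A)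
  (A_LF : LF_ode I A r)
  (invol_involute : projective_involute I gamma invol)
  (invol_convex : locally_convex_curve I invol)
  (invol_neq : forall t, I t -> invol t <> gamma t)
  (B_lift : curve_lift I invol B)
  (B_def : forall t, I t -> B t = x t *: A t + y t *: derive1 A t)
  (B_normalized : forall t, I t -> exists l : R, derive1n 3 B t = l *: B t) :
  exists C : R,
    [/\ forall t, I t -> x t = C - derive1 y t,
        forall t, I t ->
          derive1n 4 y t + 2%:R * (derive1n 3 y t * (derive1 y t - C) / y t)
            + 3%:R * r t * derive1 y t + derive1 r t * y t = 0,
        dancing_mate I (fun t => <[A t]>%VS)
            (fun t => <[cross (B t) (derive1 B t)]>%VS)
          <-> (forall t, I t -> x t + derive1 y t = 0),
        (forall t, I t -> x t + derive1 y t = 0) <-> C = 0 &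
        C = 0 ->
        forall t, I t ->
          derive1n 4 y t + 2%:R * (derive1n 3 y t * derive1 y t / y t)
            + 3%:R * r t * derive1 y t + derive1 r t * y t = 0].
Proof.
have [sA cA] := A_lift; have [sB cB] := B_lift.
have D0 := curve_lift_det3_neq0 I_open gamma_convex A_lift.
have W0 := curve_lift_det3_neq0 I_open invol_convex B_lift.
have [sr sx sy] := LF_coef_smooth I_open sA sB A_LF D0 B_def.
(* If y vanished at t, B would be a multiple of A there and the involute would meet the curve at the
   same parameter. *)
have y0 t : I t -> y t != 0.
  move=> It; apply/eqP => yt0; apply: (invol_neq t It).
  have [Bt0 ->] := cB t It; have [_ ->] := cA t It.
  move: Bt0; rewrite B_def // yt0 scale0r addr0 => Bt0.
  by rewrite vlineZ //; apply: contraNneq Bt0 => ->; rewrite scale0r.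
have eqs := normalized_involute_eqs I_open sA A_LF sr sx sy D0 y0 B_def B_normalized.
have [t0 It0] := I_neq0.
(* The constant C is the value of x + y' at a base point; this sum has derivative zero on the
   interval. *)
have xE t : I t -> x t = x t0 + derive1 y t0 - derive1 y t.
  move=> It; apply/eqP; rewrite eq_sym subr_eq eq_sym; apply/eqP.
  apply: (@cst_on_itv _ I (fun s => x s + derive1 y s)) => // s Is.
  apply: is_derive_eq (eqs s Is).1.
  exact: is_deriveD (smooth_on_is_derive 0 sx Is) (smooth_on_is_derive 1 sy Is).
have ode t : I t ->
    derive1n 4 y t
      + 2%:R * (derive1n 3 y t * (derive1 y t - (x t0 + derive1 y t0)) / y t)
      + 3%:R * r t * derive1 y t + derive1 r t * y t = 0.
  move=> It; have [_] := eqs t It.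
  (* Substituting x = C - y' turns - 2 y''' x / y into 2 y''' (y' - C) / y. *)
  by rewrite {1}xE // -(opprB (derive1 y t)) mulrN mulNr mulrN opprK.
have C0 : (forall t, I t -> x t + derive1 y t = 0) <-> x t0 + derive1 y t0 = 0.
  by split=> [/(_ t0 It0) //|C0 t It]; rewrite xE // C0 sub0r addNr.
exists (x t0 + derive1 y t0); split=> //.
- split.
    exact: (dancing_mate_sum0 I_open I_itv sA sB A_LF D0 W0 y0 B_def
      B_normalized).
  exact: (sum0_dancing_mate I_open I_itv sA sB A_LF D0 W0 y0 B_def B_normalized
    I_neq0).
- by move=> C0' t It; have := ode t It; rewrite C0' subr0.
Qed.
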